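(* Let $p\ge2$ be an even integer. (a) Let $\mu,\nu\in\mathcal{P}_p(\mathbb{R})$ be such that $e_{2,p}(\mu,\cdot)=e_{2,p}(\nu,\cdot)+C$ on $\mathbb{R}^2$ for some real constant $C$. Then $\mu=\nu$. (b) If $\mu_n\in\mathcal{P}_p(\mathbb{R})$ for $n\in\mathbb{N}^*\cup\{\infty\}$, the following properties are equivalent: (i) $\mathcal{W}_p(\mu_n,\mu_\infty)\to0$ as $n\to+\infty$; (ii) $e_{2,p}(\mu_n,\cdot)\to e_{2,p}(\mu_\infty,\cdot)$ uniformly on $\mathbb{R}^2$; (iii) $e_{2,p}(\mu_n,\cdot)\to e_{2,p}(\mu_\infty,\cdot)$ pointwise on $\mathbb{R}^2$. (c) The distances $\mathcal{Q}_{2,p}$ and $\mathcal{W}_p$ are topologically equivalent on $\mathcal{P}_p(\mathbb{R})$, and $N_{1,p}=2$.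
   Context: $\mathcal{P}_p(\mathbb{R})$ is the set of Borel probability measures on $\mathbb{R}$ with finite $p$-th moment; $\mathcal{W}_p$ is the $L^p$-Wasserstein distance. For $\mu\in\mathcal{P}_p(\mathbb{R})$, $N\ge1$ and $(x_1,\dots,x_N)\in\mathbb{R}^N$, $e_{N,p}(\mu,(x_1,\dots,x_N))=\big[\int_{\mathbb{R}}\min_{1\le i\le N}|\xi-x_i|^p\,\mu(d\xi)\big]^{1/p}$, and $\mathcal{Q}_{N,p}(\mu,\nu)=\sup_{x\in\mathbb{R}^N}|e_{N,p}(\mu,x)-e_{N,p}(\nu,x)|$. $N_{1,p}$ (the first index being the dimension $d=1$) is the smallest $N\in\mathbb{N}^*$ such that both: (1) for all $\mu,\nu\in\mathcal{P}_p(\mathbb{R})$, $e_{N,p}(\mu,\cdot)=e_{N,p}(\nu,\cdot)+C$ for some real constant $C$ implies $\mu=\nu$ (and $C=0$); (2) for all $\mu_n$ ($n\ge1$), $\mu_\infty\in\mathcal{P}_p(\mathbb{R})$, pointwise convergence $e_{N,p}(\mu_n,\cdot)\to e_{N,p}(\mu_\infty,\cdot)$ implies $\mathcal{W}_p(\mu_n,\mu_\infty)\to0$. Two distances are topologically equivalent if they induce the same topology. *)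

(* Defs.v *)
From HB Require Import structures.
From mathcomp Require Import all_boot all_order all_algebra.
From mathcomp Require Import all_classical all_reals all_analysis.

Set Implicit Arguments.
Unset Strict Implicit.
Unset Printing Implicit Defensive.

Import Order.TTheory GRing.Theory Num.Theory.
Import numFieldNormedType.Exports.

Local Open Scope classical_set_scope.
Local Open Scope ring_scope.

(* [measurableTypeR R] is R with its Borel sigma-algebra. *)
Record Pp (R : realType) (p : nat) := MkPp {
  law :> probability (measurableTypeR R) R;
  finite_moment : (\int[law]_xi (`|(xi : R)| ^+ p)%:E < +oo)%E
}.

(* Equality of measures.  A library measure is a function on all subsets of
   its space, so Leibniz equality would also constrain the meaningless values
   on nonmeasurable sets. *)
Definition eq_law (R : realType) (p : nat) (mu nu : Pp R p) : Prop :=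
  forall A : set (measurableTypeR R), measurable A -> mu A = nu A.

Definition coupling (R : realType) (p : nat) (mu nu : Pp R p) :
    set (probability (measurableTypeR R * measurableTypeR R)%type R) :=
  [set pi | (forall A : set (measurableTypeR R), measurable A ->
               pi (A `*` setT) = mu A) /\
            (forall B : set (measurableTypeR R), measurable B ->
               pi (setT `*` B) = nu B)].

Definition wasserstein (R : realType) (p : nat) (mu nu : Pp R p) : \bar R :=
  poweR (ereal_inf [set (\int[pi]_z (`|(z.1 : R) - (z.2 : R)| ^+ p)%:E)%E |
                    pi in coupling mu nu])
        (p%:R^-1).

(* The quantization error e_{N,p}.  For N >= 1 the minimum is a real number and
   the integral is finite, so [fine] loses nothing; the neutral element +oo is
   only the value of the minimum for N = 0. *)
Definition qerr (R : realType) (p N : nat) (mu : Pp R p) (x : 'rV[R]_N) : R :=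
  fine (\int[mu]_xi
          \big[Order.min/+oo]_(i < N) (`|(xi : R) - x ord0 i| ^+ p)%:E)%E
    `^ (p%:R^-1).

Definition qdist (R : realType) (p N : nat) (mu nu : Pp R p) : \bar R :=
  ereal_sup (range (fun x : 'rV[R]_N => (`|qerr mu x - qerr nu x|)%:E)).

Definition separating (R : realType) (p N : nat) : Prop :=
  forall (mu nu : Pp R p) (C : R),
    (forall x : 'rV[R]_N, qerr mu x = qerr nu x + C) ->
    eq_law mu nu /\ C = 0.

Definition convergence_determining (R : realType) (p N : nat) : Prop :=
  forall (mu_ : nat -> Pp R p) (mu : Pp R p),
    (forall x : 'rV[R]_N, qerr (mu_ n) x @[n --> \oo] --> qerr mu x) ->
    wasserstein (mu_ n) mu @[n --> \oo] --> 0%E.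

(* N is the number N_{1,p}, the first index being the dimension of the space. *)
Definition is_N1 (R : realType) (p N : nat) : Prop :=
  let good M := [/\ (0 < M)%N, separating R p M
                  & convergence_determining R p M] in
  good N /\ forall M : nat, good M -> (N <= M)%N.

Definition is_distance (R : realType) (p : nat)
    (d : Pp R p -> Pp R p -> \bar R) : Prop :=
  [/\ forall mu nu, d mu nu \is a fin_num /\ (0 <= d mu nu)%E,
      forall mu nu, d mu nu = 0%E <-> eq_law mu nu,
      forall mu nu, d mu nu = d nu mu
    & forall mu nu rho, (d mu rho <= d mu nu + d nu rho)%E].

Definition dist_open (T : Type) (R : realType) (d : T -> T -> \bar R)
    (U : set T) : Prop :=
  forall x, U x -> exists2 eps : R, 0 < eps &
    forall y, (d x y < eps%:E)%E -> U y.

Definition topologically_equivalent (T : Type) (R : realType)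
    (d1 d2 : T -> T -> \bar R) : Prop :=
  forall U : set T, dist_open d1 U <-> dist_open d2 U.

(* Main.v *)
(** For even [p] and a centre [m], the finite difference of order [p - 1] in [h]
    of [(x - m + h)^p - min ((x - m + h)^p) ((x - m - h)^p)] equals
    [2 p! (x - m)^+].  Hence the potential [m |-> E (X - m)^+] is a finite linear
    combination of values of [e_{2,p}^p], and the potential determines the
    distribution function.  A constant [C] in (a) must vanish because
    [e(a,a)^p + e(-a,-a)^p = 2 a^p + O(a^(p-2))], whereas adding [C > 0] to both
    errors adds at least [C a^(p-1)].

    For (b), [|e(mu,.) - e(nu,.)| <= W_p] is Minkowski's inequality on a coupling.
    Conversely, pointwise convergence of the errors gives convergence of the
    potentials, hence of the quantile functions outside the countable set of
    values of the limiting distribution function at rational points, and it gives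
    convergence of the [p]-th absolute moments; together these yield convergence
    in [L^p(0,1)] of the quantile functions, which couple the laws.

    For [N = 1] the error only depends on the first [p] moments, and the even and
    odd binomial weights of order [p + 1] share these moments. *)

Require Import Defs.
From HB Require Import structures.
From mathcomp Require Import all_boot all_order all_algebra.
From mathcomp Require Import all_classical all_reals all_analysis.
From mathcomp Require Import measurable_realfun.
From mathcomp Require Import ring lra.

Set Implicit Arguments.
Unset Strict Implicit.
Unset Printing Implicit Defensive.

Import Order.TTheory GRing.Theory Num.Theory.
Import numFieldNormedType.Exports.

Local Open Scope classical_set_scope.
Local Open Scope ring_scope.

(** * Finite differences *)

(** The forward difference $(\Delta^n f)(0)$ with unit step. *)
Definition fdiff (R : comPzRingType) (n : nat) (f : nat -> R) : R :=
  \sum_(i < n.+1) (-1) ^+ (n - i) * 'C(n, i)%:R * f i.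

Lemma eq_fdiff (R : comPzRingType) (n : nat) (f g : nat -> R) :
  f =1 g -> fdiff n f = fdiff n g.
Proof. by move=> fg; apply: eq_bigr => i _; rewrite fg. Qed.

(** Pascal's rule, in the form $\Delta^{n+1} = \Delta^n \Delta$. *)
Lemma fdiffS (R : comPzRingType) (n : nat) (f : nat -> R) :
  fdiff n.+1 f = fdiff n (fun i => f i.+1 - f i).
Proof.
rewrite /fdiff; under [RHS]eq_bigr do rewrite mulrBr.
rewrite [RHS]sumrB [X in _ = X - _]big_ord_recr [X in _ = _ - X]big_ord_recl.
rewrite [LHS]big_ord_recl big_ord_recr !lift0 /= !subnn !binn !bin0 !subn0 exprS.
under eq_bigr => i _ do
  rewrite /bump leq0n add1n subSS binS natrD mulrDr mulrDl.
rewrite big_split /=.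
have -> : \sum_(i < n) (-1) ^+ (n - i) * 'C(n, i.+1)%:R * f i.+1 =
   - \sum_(i < n) (-1) ^+ (n - bump 0 i) * 'C(n, bump 0 i)%:R * f (bump 0 i) :> R.
  rewrite -sumrN; apply: eq_bigr => i _.
  rewrite /bump leq0n add1n -!mulNr; congr (_ * _ * _).
  by rewrite -(subnSK (ltn_ord i)) exprS mulN1r.
under [X in _ = _ - (_ + X)]eq_bigr do rewrite /bump leq0n add1n.
ring.
Qed.

Lemma fdiff_sum (R : comPzRingType) (n m : nat) (c : 'I_m -> R)
    (f : 'I_m -> nat -> R) :
  fdiff n (fun i => \sum_j c j * f j i) = \sum_j c j * fdiff n (f j).
Proof.
rewrite /fdiff; under eq_bigr do rewrite mulr_sumr.
rewrite exchange_big; apply: eq_bigr => j _; rewrite mulr_sumr.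
by apply: eq_bigr => i _; rewrite mulrCA.
Qed.

(** By induction on the order: one difference expands over the powers $j < k$, and only the top one,
    with coefficient $k$, can survive the remaining differences. *)
Lemma fdiff_exp (R : comPzRingType) (n k : nat) (x : R) : (k <= n)%N ->
  fdiff n (fun i => (x + i%:R) ^+ k) = ((k == n) * n`!)%:R.
Proof.
elim: n k x => [|n IHn] k x kn.
  by move: kn; rewrite leqn0 => /eqP->; rewrite /fdiff big_ord1 expr0 bin0 !mulr1.
rewrite fdiffS.
have E i : (x + i.+1%:R) ^+ k - (x + i%:R) ^+ k =
    \sum_(j < k) 'C(k, j)%:R * (x + i%:R) ^+ j.
  rewrite -natr1 addrA [_ + 1]addrC exprDn big_ord_recr /= subnn binn expr0 mulr1n.
  rewrite mul1r addrK; apply: eq_bigr => j _.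
  by rewrite expr1n mul1r mulr_natl.
rewrite (eq_fdiff _ E) fdiff_sum.
move: kn; rewrite leq_eqVlt ltnS => /predU1P[->|kn].
  rewrite big_ord_recr /= IHn// !eqxx !mul1n big1 ?add0r.
    by rewrite -natrM binSn factS.
  by move=> j _; rewrite IHn ?(ltnW (ltn_ord j))// ltn_eqF ?ltn_ord// mulr0.
rewrite (ltn_eqF (kn : k < n.+1)%N) big1// => j _.
have jn : (j < n)%N by exact: leq_trans (ltn_ord j) kn.
by rewrite IHn ?(ltnW jn)// ltn_eqF// mulr0.
Qed.

(** The terms of degree $n+1$ cancel, which leaves a polynomial of degree at most $n$ whose
    coefficient of degree $n$ is $(n+1)(x-y)$. *)
Lemma fdiff_expS (R : comPzRingType) (n : nat) (x y : R) :
  fdiff n (fun i => (x + i%:R) ^+ n.+1 - (y + i%:R) ^+ n.+1) =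
  (x - y) * (n.+1)`!%:R.
Proof.
have E i : (x + i%:R) ^+ n.+1 - (y + i%:R) ^+ n.+1 =
    \sum_(j < n.+1) ((x - y) ^+ (n.+1 - j) * 'C(n.+1, j)%:R) * (y + i%:R) ^+ j.
  rewrite -[x in LHS](subrK y) -[in LHS]addrA exprDn big_ord_recr /=.
  rewrite subnn binn expr0 mulr1n mul1r addrK; apply: eq_bigr => j _.
  by rewrite mulrAC mulr_natr.
rewrite (eq_fdiff _ E) fdiff_sum big_ord_recr /= big1 ?add0r.
  by rewrite fdiff_exp// eqxx mul1n subSnn expr1 binSn -mulrA -natrM factS.
by move=> j _; rewrite fdiff_exp ?(ltnW (ltn_ord j))// ltn_eqF ?ltn_ord// mulr0.
Qed.

Lemma even_exprBC (R : pzRingType) (p : nat) (x y : R) : ~~ odd p ->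
  (x - y) ^+ p = (y - x) ^+ p.
Proof. by move=> p_even; rewrite -opprB exprNn -signr_odd (negbTE p_even) mul1r. Qed.

Lemma ler_even_exprDB (R : realDomainType) (p : nat) (t h : R) : ~~ odd p ->
  0 <= h -> 0 <= t -> (t - h) ^+ p <= (t + h) ^+ p.
Proof.
move=> p_even h0 t0.
rewrite -[leLHS]ger0_norm ?exprn_even_ge0// normrX.
by apply: lerXn2r; rewrite ?nnegrE ?addr_ge0// ler_norml; lra.
Qed.

(* The bracket is odd in [h] once the sign of [t] is fixed, and has degree
   [p - 1] in [h]; the finite difference of order [p - 1] in [h] selects its
   leading term [2 p t h^(p-1)]. *)
Lemma fdiff_min_expr (R : realDomainType) (n : nat) (t : R) : odd n ->
  fdiff n (fun h => (t + h%:R) ^+ n.+1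
                      - Num.min ((t + h%:R) ^+ n.+1) ((t - h%:R) ^+ n.+1)) =
  (n.+1)`!.*2%:R * Num.max t 0.
Proof.
move=> n_odd; have p_even : ~~ odd n.+1 by rewrite /= n_odd.
have [t0|t0] := leP 0 t.
  rewrite -(@eq_fdiff _ _ (fun i => (t + i%:R) ^+ n.+1 - (- t + i%:R) ^+ n.+1)).
    by rewrite fdiff_expS -muln2 natrM; ring.
  move=> h; rewrite min_r; last by rewrite ler_even_exprDB.
  by congr (_ - _); rewrite addrC even_exprBC.
(* For $t < 0$ one has $|t+h| \le |t-h|$, so the minimum is its first argument and every bracket is
   zero. *)
rewrite mulr0 /fdiff big1// => h _.
rewrite min_l ?subrr ?mulr0//.
have -> : t + h%:R = h%:R - - t by rewrite opprK addrC.
have -> : t - h%:R = - h%:R - - t by rewrite opprK addrC.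
rewrite [in leRHS]even_exprBC// [in leLHS]even_exprBC// opprK.
by rewrite ler_even_exprDB// oppr_ge0 ltW.
Qed.

(** Odd powers of [x] cancel between the two expansions, and even powers contribute nonnegative
    terms. Beyond the constant term $2a^p$, each has at most $a^{p-2}$, and the binomial
    coefficients sum to at most $2^p$. *)
Lemma sum_even_expr_bounds (R : realFieldType) (p : nat) (a x : R) : ~~ odd p ->
  (2 <= p)%N -> 1 <= a ->
  2 * a ^+ p <= (x - a) ^+ p + (x + a) ^+ p <=
    2 * a ^+ p + (2 ^ p.+1)%:R * a ^+ p.-2 * (1 + x ^+ p).
Proof.
move=> p_even p2 a1; have a0 : 0 <= a by rewrite (le_trans _ a1).
have xj j : (j <= p)%N -> `|x| ^+ j <= 1 + x ^+ p.
  move=> jp; rewrite -[x ^+ p]ger0_norm ?exprn_even_ge0// normrX.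
  have [x1|/ltW x1] := leP `|x| 1.
    by rewrite (@le_trans _ _ 1) ?exprn_ile1 ?lerDl ?exprn_ge0.
  by rewrite (@le_trans _ _ (`|x| ^+ p)) ?ler_weXn2l// lerDr.
have -> : (x - a) ^+ p + (x + a) ^+ p =
    \sum_(j < p.+1) (a ^+ (p - j) * x ^+ j) *+ 'C(p, j) * (1 + (-1) ^+ j).
  rewrite even_exprBC// [x + a]addrC !exprDn -big_split /=.
  apply: eq_bigr => j _; rewrite (exprNn x) -!(mulr_natr (_ * _)).
  by move: ('C(p, j)%:R) (a ^+ _) (x ^+ _) ((-1) ^+ _) => C A X S; ring.
rewrite big_ord_recl /= subn0 bin0 !expr0 mulr1 mulr1n -[1 + 1]/(2%:R) mulrC.
have T0 (j : 'I_p) : 0 <=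
   (a ^+ (p - bump 0 j) * x ^+ bump 0 j) *+ 'C(p, bump 0 j) * (1 + (-1) ^+ bump 0 j).
  case: (boolP (odd (bump 0 j))) => oj.
    by rewrite -signr_odd oj expr1 subrr mulr0.
  rewrite -signr_odd (negbTE oj) mulr_ge0 ?addr_ge0// mulrn_wge0//.
  by rewrite mulr_ge0 ?(exprn_ge0 _ a0) ?exprn_even_ge0.
rewrite lerDl sumr_ge0 //= lerD2l.
apply: (@le_trans _ _
  (\sum_(j < p) 2 * 'C(p, bump 0 j)%:R * (a ^+ p.-2 * (1 + x ^+ p)))).
  apply: ler_sum => j _.
  case: (boolP (odd (bump 0 j))) => oj.
    rewrite -signr_odd oj expr1 subrr mulr0 !mulr_ge0 ?(exprn_ge0 _ a0)//.
    by rewrite addr_ge0 ?exprn_even_ge0.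
  rewrite -signr_odd (negbTE oj) expr0 -[1 + 1]/(2%:R) mulrC -mulrA ler_pM2l//.
  rewrite -[leLHS]mulr_natl ler_wpM2l//.
  (* [bump 0 j] is $j+1$, so it is nonzero; being even it is at least 2, whence the exponent $p-2$
     of [a]. *)
  have j2 : (2 <= bump 0 j)%N by case: (val j) oj.
  apply: ler_pM; rewrite ?(exprn_ge0 _ a0) ?exprn_even_ge0//.
    apply: ler_weXn2l => //; rewrite -subn2; exact: leq_sub2l.
  apply: le_trans (xj (bump 0 j) _); last by rewrite /bump leq0n add1n ltn_ord.
  by rewrite -normrX ler_norm.
rewrite -mulr_suml -mulr_sumr -natr_sum -[leRHS]mulrA; apply: ler_wpM2r.
  by rewrite mulr_ge0 ?(exprn_ge0 _ a0) ?addr_ge0 ?exprn_even_ge0.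
rewrite -natrM ler_nat expnS leq_mul2l /=.
have := Pascal 1 1 p; rewrite addnn => ->.
rewrite big_ord_recl /= -[leqLHS]add0n leq_add//.
by apply: leq_sum => j _; rewrite !exp1n !muln1.
Qed.

(** * Quantization errors and potentials *)

Lemma exprDn_le (R : realDomainType) (p : nat) (x y : R) : 0 <= x -> 0 <= y ->
  (x + y) ^+ p <= 2 ^+ p * (x ^+ p + y ^+ p).
Proof.
move=> x0 y0; have [xy|/ltW yx] := leP x y.
  apply: (@le_trans _ _ ((2 * y) ^+ p)).
    by apply: lerXn2r; rewrite ?nnegrE ?mulr_ge0 ?addr_ge0//; lra.
  by rewrite exprMn ler_wpM2l ?exprn_ge0// lerDr exprn_ge0.
apply: (@le_trans _ _ ((2 * x) ^+ p)).
  by apply: lerXn2r; rewrite ?nnegrE ?mulr_ge0 ?addr_ge0//; lra.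
by rewrite exprMn ler_wpM2l ?exprn_ge0// lerDl exprn_ge0.
Qed.

Section integrable_EFin.
Context d (T : measurableType d) (R : realType).
Variables (mu : {measure set T -> \bar R}) (D : set T) (mD : measurable D).
Variables f g : T -> R.
Hypotheses (fi : mu.-integrable D (EFin \o f)) (gi : mu.-integrable D (EFin \o g)).

Lemma integrable_EFinZ (c : R) : mu.-integrable D (EFin \o (fun x => c * f x)).
Proof.
by apply: eq_integrable (integrableZl mD c fi) => // x _; rewrite /= EFinM.
Qed.

Lemma integrable_EFinD : mu.-integrable D (EFin \o (fun x => f x + g x)).
Proof.
by apply: eq_integrable (integrableD mD fi gi) => // x _; rewrite /= EFinD.
Qed.

Lemma integrable_EFinB : mu.-integrable D (EFin \o (fun x => f x - g x)).
Proof.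
by apply: eq_integrable (integrableB mD fi gi) => // x _; rewrite /= EFinB.
Qed.

End integrable_EFin.

Lemma integrable_growth (R : realType) (p : nat) (mu : Pp R p) (f : R -> R)
    (K : R) : measurable_fun setT f -> (forall x, `|f x| <= K * (1 + `|x| ^+ p)) ->
  (law mu).-integrable setT (EFin \o f).
Proof.
move=> mf fK.
have mX : measurable_fun setT (fun x : R => `|x| ^+ p).
  by apply: measurable_funX; exact: normr_measurable.
have iX : (law mu).-integrable setT (EFin \o (fun x : R => `|x| ^+ p)).
  apply/integrableP; split; first exact/measurable_EFinP.
  apply: le_lt_trans (finite_moment mu).
  by rewrite le_eqVlt; apply/orP; left; apply/eqP; apply: eq_integral => x _;
    rewrite /= normrX normr_id.
have i1 : (law mu).-integrable setT (EFin \o (fun x : R => 1 : R)).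
  exact: finite_measure_integrable_cst.
have iK : (law mu).-integrable setT (EFin \o (fun x : R => K * (1 + `|x| ^+ p))).
  by apply: integrable_EFinZ => //; exact: integrable_EFinD.
apply: le_integrable iK => //; first exact/measurable_EFinP.
move=> x _ /=; rewrite lee_fin (le_trans (fK x))// ler_norm//.
Qed.

(** This is $e_{2,p}^p$; on the diagonal $a = b$ it is $e_{1,p}^p$. *)
Definition quant (R : realType) (p : nat) (mu : Pp R p) (a b : R) : R :=
  \int[law mu]_xi Num.min (`|(xi : R) - a| ^+ p) (`|(xi : R) - b| ^+ p).

Lemma integrable_min (R : realType) (p : nat) (mu : Pp R p) (a b : R) :
  (law mu).-integrable setT (EFin \o (fun xi : R =>
    Num.min (`|(xi : R) - a| ^+ p) (`|(xi : R) - b| ^+ p))).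
Proof.
apply: (@integrable_growth _ _ _ _ (2 ^+ p * (1 + `|a| ^+ p))).
  apply: measurable_minr; apply: measurable_funX; apply: measurableT_comp => //;
  exact: measurable_funB.
move=> x; rewrite ger0_norm; last by rewrite le_min !exprn_ge0.
rewrite ge_min; apply/orP; left.
apply: (@le_trans _ _ ((`|x| + `|a|) ^+ p)).
  by apply: lerXn2r; rewrite ?nnegrE ?addr_ge0// ler_normB.
apply: le_trans (exprDn_le p _ _) _ => //; rewrite -mulrA ler_wpM2l ?exprn_ge0//.
have : 0 <= `|x| ^+ p by rewrite exprn_ge0.
have : 0 <= `|a| ^+ p by rewrite exprn_ge0.
nra.
Qed.

Lemma quant_ge0 (R : realType) (p : nat) (mu : Pp R p) (a b : R) :
  0 <= quant mu a b.
Proof. by apply: Rintegral_ge0 => x _; rewrite le_min !exprn_ge0. Qed.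

Lemma qerr2E (R : realType) (p : nat) (mu : Pp R p) (x : 'rV[R]_2) :
  qerr mu x = quant mu (x ord0 ord0) (x ord0 (lift ord0 ord0)) `^ p%:R^-1.
Proof.
rewrite /qerr /quant /Rintegral; congr (fine _ `^ _).
apply: eq_integral => xi _.
by rewrite big_ord_recl big_ord_recl big_ord0 miney EFin_min.
Qed.

Lemma qerr1E (R : realType) (p : nat) (mu : Pp R p) (x : 'rV[R]_1) :
  qerr mu x = quant mu (x ord0 ord0) (x ord0 ord0) `^ p%:R^-1.
Proof.
rewrite /qerr /quant /Rintegral; congr (fine _ `^ _).
apply: eq_integral => xi _.
by rewrite big_ord_recl big_ord0 miney minxx.
Qed.

Lemma powR_invrK (R : realType) (p : nat) (x : R) : (0 < p)%N -> 0 <= x ->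
  (x `^ p%:R^-1) ^+ p = x.
Proof.
move=> p0 x0; rewrite -powR_mulrn ?powR_ge0// -powRrM mulVf ?powRr1//.
by rewrite pnatr_eq0 -lt0n.
Qed.

Definition pair_row (R : Type) (a b : R) : 'rV[R]_2 :=
  \row_i (if i == ord0 then a else b).

Lemma quant_qerr (R : realType) (p : nat) (mu : Pp R p) (a b : R) : (0 < p)%N ->
  quant mu a b = qerr mu (pair_row a b) ^+ p.
Proof. by move=> p0; rewrite qerr2E !mxE /= powR_invrK// quant_ge0. Qed.

Definition potential (R : realType) (p : nat) (mu : Pp R p) (m : R) : R :=
  \int[law mu]_xi Num.max ((xi : R) - m) 0.

Lemma integrable_potential (R : realType) (p : nat) (mu : Pp R p.+1) (m : R) :
  (law mu).-integrable setT (EFin \o (fun xi : R => Num.max (xi - m) 0)).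
Proof.
apply: (@integrable_growth _ _ _ _ (1 + `|m|)).
  by apply: measurable_maxr => //; exact: measurable_funB.
move=> x; rewrite ger0_norm ?le_max ?lexx ?orbT//.
have x1 : `|x| <= 1 + `|x| ^+ p.+1.
  have [x1|/ltW x1] := leP `|x| 1; first by rewrite (le_trans x1)// lerDl exprn_ge0.
  by rewrite (@le_trans _ _ (`|x| ^+ p.+1)) ?lerDr// -[leLHS]expr1 ler_weXn2l.
have X0 : 0 <= `|x| ^+ p.+1 by rewrite exprn_ge0.
have M0 : 0 <= `|m| by [].
rewrite ge_max; apply/andP; split; last nra.
by apply: le_trans (ler_norm _) (le_trans (ler_normB _ _) _); nra.
Qed.

Lemma Rintegral_fdiff (R : realType) (p n : nat) (mu : Pp R p) (f : nat -> R -> R) :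
  (forall i, (law mu).-integrable setT (EFin \o f i)) ->
  \int[law mu]_xi fdiff n (f^~ xi) = fdiff n (fun i => \int[law mu]_xi f i xi).
Proof.
move=> intf.
have iZ (c : R) i : (law mu).-integrable setT (fun xi => (c * f i xi)%:E).
  exact: integrable_EFinZ (intf i) _.
rewrite /fdiff [LHS]/Rintegral.
under eq_integral do rewrite -sumEFin.
rewrite integral_sum//= -sum_fine => [|i _]; last exact: integrable_fin_num.
by apply: eq_bigr => i _; rewrite -RintegralZl.
Qed.

Lemma potentialE (R : realType) (n : nat) (mu : Pp R n.+1) (m : R) : odd n ->
  (n.+1)`!.*2%:R * potential mu m =
  fdiff n (fun i => quant mu (m - i%:R) (m - i%:R) - quant mu (m - i%:R) (m + i%:R)).
Proof.
move=> n_odd; have p_even : ~~ odd n.+1 by rewrite /= n_odd.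
(* The bracket of [fdiff_min_expr] at $t = \xi - m$ and $h = i$. Its first term is written as a
   minimum of two equal distances, so that it integrates to [quant] on the diagonal. *)
pose D i xi := Num.min (`|xi - (m - i%:R)| ^+ n.+1) (`|xi - (m - i%:R)| ^+ n.+1)
  - Num.min (`|xi - (m - i%:R)| ^+ n.+1) (`|xi - (m + i%:R)| ^+ n.+1).
have DE xi : fdiff n (D^~ xi) = (n.+1)`!.*2%:R * Num.max (xi - m) 0.
  rewrite -fdiff_min_expr//; apply: eq_fdiff => i; rewrite /D minxx.
  rewrite -!normrX !ger0_norm ?exprn_even_ge0//.
  by rewrite (_ : xi - (m - i%:R) = xi - m + i%:R) 1?opprD ?addrA//; ring.
have iD i : (law mu).-integrable setT (EFin \o D i).
  by apply: integrable_EFinB => //; exact: integrable_min.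
transitivity (\int[law mu]_xi fdiff n (D^~ xi)).
  rewrite /potential -RintegralZl//.
    by apply: eq_Rintegral => xi _; rewrite DE.
  exact: integrable_potential.
rewrite Rintegral_fdiff//; apply: eq_fdiff => i.
by rewrite RintegralB//; exact: integrable_min.
Qed.

(** * Potentials determine the law *)

Definition cdfr (R : realType) (mu : probability (measurableTypeR R) R) (x : R) : R :=
  fine (mu `]-oo, x]%classic).

Section cdfr.
Context (R : realType) (mu : probability (measurableTypeR R) R).

(** The identity as a random variable has law [mu], so the limits known for the [cdf] of a random
    variable transfer to [cdfr]. *)
Let idTR : measurableTypeR R -> R := idfun.

#[local] HB.instance Definition _ :=
  @isMeasurableFun.Build _ _ _ _ idTR (@measurable_id _ _ setT).

Lemma cdfrE (x : R) : mu `]-oo, x]%classic = (cdfr mu x)%:E.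
Proof. by rewrite /cdfr fineK ?fin_num_measure. Qed.

Lemma cdfr_nd (x y : R) : x <= y -> cdfr mu x <= cdfr mu y.
Proof.
move=> xy; rewrite -lee_fin -!cdfrE; apply: le_measure; rewrite ?inE//.
by apply: subset_itvl; rewrite bnd_simp.
Qed.

Lemma cdfr_right_continuous : right_continuous (cdfr mu).
Proof.
move=> a; apply: fine_cvg; rewrite -cdfrE.
exact: (@cdf_right_continuous _ _ _ mu (idTR : {RV mu >-> R}) a).
Qed.

Lemma cvg_cdfrNy : cdfr mu @ -oo --> (0 : R).
Proof. exact/fine_cvg/(cvg_cdfNy0 (idTR : {RV mu >-> R})). Qed.

Lemma cvg_cdfry : cdfr mu @ +oo --> (1 : R).
Proof. exact/fine_cvg/(cvg_cdfy1 (idTR : {RV mu >-> R})). Qed.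

End cdfr.

(** This form of right continuity serves to compare two distribution functions and to see that the
    infimum defining a quantile is attained. *)
Lemma cdfr_rlimit (R : realType) (mu : probability (measurableTypeR R) R) (x c : R) :
  (forall y, x < y -> c <= cdfr mu y) -> c <= cdfr mu x.
Proof.
move=> cy; apply: (cvgr_to_ge (@cdfr_right_continuous R mu x)).
by near=> y; apply: cy; near: y; exact: nbhs_right_gt.
Unshelve. all: by end_near. Qed.

(** The rays []x, +oo[] are stable under intersection and generate the Borel sets; their masses
    follow from [cdfr] by complement. *)
Lemma eq_cdfr (R : realType) (mu nu : probability (measurableTypeR R) R) :
  cdfr mu =1 cdfr nu ->
  forall A : set (measurableTypeR R), measurable A -> mu A = nu A.
Proof.
move=> munu A mA.
apply: (@measure_unique _ R (measurableTypeR R) (@RGenOInfty.G R)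
  (fun n => `](- n%:R), +oo[%classic) _ _ _ _ mu nu) => //.
- exact: RGenOInfty.measurableE.
- move=> _ _ [x ->] [y ->]; exists (Num.max x y).
  by apply/seteqP; split=> z /=; rewrite !in_itv/= !andbT gt_max => /andP.
- by move=> i; exists (- i%:R).
- apply/seteqP; split=> // x _; exists (Num.bound `|x|) => //=.
  rewrite in_itv/= andbT ltrNl (le_lt_trans (ler_norm _))// normrN.
  exact: archi_boundP.
- move=> _ [x ->]; rewrite -setCitvl.
  have mr : measurable (`]-oo, x]%classic : set (measurableTypeR R)) by [].
  rewrite [LHS](probability_setC mu mr) [RHS](probability_setC nu mr).
  by rewrite !cdfrE munu.
- by move=> k; rewrite -ge0_fin_numE// fin_num_measure.
Qed.

Lemma Rintegral_ray (R : realType) (mu : probability (measurableTypeR R) R) (c x : R) :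
  (mu.-integrable setT (EFin \o (fun xi : R => c * (1 - \1_(`]-oo, x]%classic) xi)))) /\
  \int[mu]_xi (c * (1 - \1_(`]-oo, x]%classic) xi)) = c * (1 - cdfr mu x).
Proof.
have i1 : mu.-integrable setT (EFin \o (fun xi : R => 1 : R)).
  exact: finite_measure_integrable_cst.
have iI : mu.-integrable setT (EFin \o (\1_(`]-oo, x]%classic) : R -> R)).
  exact: integrable_indic.
have iB : mu.-integrable setT (EFin \o (fun xi : R => 1 - \1_(`]-oo, x]%classic) xi : R)).
  exact: integrable_EFinB.
split; first exact: integrable_EFinZ.
rewrite RintegralZl// RintegralB// Rintegral_cst//= probability_setT mul1r.
by rewrite /Rintegral integral_indic// setIT.
Qed.

(** As a function of [z], the difference of the ramps is 0 up to [x], rises linearly to $y-x$ at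
    [y], and stays constant afterwards. *)
Lemma ramp_bounds (R : realDomainType) (x y z : R) : x < y ->
  (y - x) * (1 - (z <= y :> R)%R%:R) <= Num.max (z - x) 0 - Num.max (z - y) 0 <=
  (y - x) * (1 - (z <= x :> R)%R%:R).
Proof.
move=> xy; apply/andP; split; rewrite /Num.max; case: (leP z) => h /=;
  case: ltP => h1; case: ltP => h2; rewrite ?subrr ?subr0 ?mulr0 ?mulr1; lra.
Qed.

(** A difference-quotient form of the fact that the potential is a primitive of [cdfr - 1]. It gives
    uniqueness and also the convergence of quantiles. *)
Lemma potential_cdfr (R : realType) (p : nat) (mu : Pp R p.+1) (x y : R) : x < y ->
  (y - x) * (1 - cdfr (law mu) y) <= potential mu x - potential mu y <=
  (y - x) * (1 - cdfr (law mu) x).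
Proof.
move=> xy.
have [ix <-] := Rintegral_ray (law mu) (y - x) x.
have [iy <-] := Rintegral_ray (law mu) (y - x) y.
rewrite /potential -RintegralB//; try exact: integrable_potential.
have iD : (law mu).-integrable setT
    (EFin \o (fun xi : R => Num.max (xi - x) 0 - Num.max (xi - y) 0)).
  by apply: integrable_EFinB => //; exact: integrable_potential.
by apply/andP; split; apply: le_Rintegral => // z _; rewrite indicE mem_setE in_itv/=;
  have /andP[] := ramp_bounds z xy.
Qed.

Lemma eq_potential (R : realType) (p : nat) (mu nu : Pp R p.+1) :
  potential mu =1 potential nu -> eq_law mu nu.
Proof.
suff H (m n : Pp R p.+1) : potential m =1 potential n ->
    forall x, cdfr (law m) x <= cdfr (law n) x.
  by move=> munu; apply: eq_cdfr => x; apply/eqP; rewrite eq_le !H//.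
(* For $y > x$ the two bounds on the common increment of the potentials give $F_m(x) \le F_n(y)$;
   then [y] decreases to [x]. *)
move=> mn x; apply: cdfr_rlimit => y xy.
have /andP[_ h1] := potential_cdfr m xy.
have /andP[+ _] := potential_cdfr n xy; rewrite -!mn => /le_trans/(_ h1).
by rewrite ler_pM2l ?subr_gt0// lerD2l lerN2.
Qed.

(** * Vanishing of the additive constant *)

Lemma qerr2_pair (R : realType) (p : nat) (mu : Pp R p) (a b : R) :
  qerr mu (pair_row a b) = quant mu a b `^ p%:R^-1.
Proof. by rewrite qerr2E !mxE. Qed.

(** Pairing the centres [a] and [- a] removes the first-moment term of order $a^{p-1}$, so a shift
    of the errors by a constant becomes visible at that order. *)
Lemma quant_diag_bounds (R : realType) (p : nat) (mu : Pp R p) : ~~ odd p ->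
  (2 <= p)%N -> exists K : R, forall a, 1 <= a ->
   2 * a ^+ p <= quant mu a a + quant mu (- a) (- a) <= 2 * a ^+ p + K * a ^+ p.-2.
Proof.
move=> p_even p2.
pose g := fun xi : R => 1 + xi ^+ p.
have ig : (law mu).-integrable setT (EFin \o g).
  apply: (@integrable_growth _ _ _ _ 1).
    by apply: measurable_funD => //; exact: measurable_funX.
  move=> x; rewrite mul1r /g -normrX ger0_norm ?addr_ge0 ?exprn_even_ge0//.
  by rewrite lerD2l ler_norm.
exists ((2 ^ p.+1)%:R * \int[law mu]_xi g xi) => a a1.
have Q b : quant mu b b = \int[law mu]_xi (xi - b) ^+ p.
  apply: eq_Rintegral => xi _; rewrite minxx -normrX ger0_norm//.
  exact: exprn_even_ge0.
have iQ b : (law mu).-integrable setT (EFin \o (fun xi : R => (xi - b) ^+ p)).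
  have := integrable_min mu b b; apply: eq_integrable => // xi _ /=.
  by rewrite minxx -normrX ger0_norm// exprn_even_ge0.
have iS : (law mu).-integrable setT
    (EFin \o (fun xi : R => (xi - a) ^+ p + (xi - - a) ^+ p)).
  exact: integrable_EFinD.
have i2 c : (law mu).-integrable setT (EFin \o (fun xi : R => c : R)).
  exact: finite_measure_integrable_cst.
have icg c : (law mu).-integrable setT (EFin \o (fun xi : R => c * g xi)).
  exact: integrable_EFinZ.
have cst c : \int[law mu]_xi c = c :> R.
  by rewrite Rintegral_cst//= (probability_setT (law mu)) mulr1.
rewrite !Q -RintegralD// -[X in _ <= _ <= X + _]cst -[X in X <= _]cst.
rewrite mulrAC -RintegralZl// -RintegralD//.
have iR : (law mu).-integrable setT
    (EFin \o (fun xi : R => 2 * a ^+ p + (2 ^ p.+1)%:R * a ^+ p.-2 * g xi)).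
  exact: integrable_EFinD.
by apply/andP; split; apply: le_Rintegral => // xi _; rewrite opprK;
  have /andP[] := sum_even_expr_bounds xi p_even p2 a1.
Qed.

Lemma qerr2_shift_eq0 (R : realType) (p : nat) (mu nu : Pp R p) (C : R) :
  ~~ odd p -> (2 <= p)%N ->
  (forall x : 'rV[R]_2, qerr mu x = qerr nu x + C) -> C = 0.
Proof.
move=> p_even p2.
have p0 : (0 < p)%N by apply: leq_trans p2.
(* Exchanging the two laws replaces [C] by [- C], so one sign suffices. *)
suff {mu nu C} H (mu nu : Pp R p) (C : R) :
    (forall x : 'rV[R]_2, qerr mu x = qerr nu x + C) -> C <= 0.
  move=> munu; apply/eqP; rewrite eq_le (H mu nu)//= -oppr_le0.
  by apply: (H nu mu) => x; rewrite munu addrK.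
move=> munu; rewrite leNgt; apply/negP => C0.
have [K hK] := quant_diag_bounds mu p_even p2.
have [L hL] := quant_diag_bounds nu p_even p2.
(* With this choice $Ca = C + |K| > K$, which contradicts the inequality $Ca^{p-1} \le Ka^{p-2}$
   reached below. *)
pose a := 1 + `|K| / C.
have a1 : 1 <= a by rewrite lerDl divr_ge0// ltW.
have a0 : 0 < a by rewrite (lt_le_trans _ a1).
have /andP[_] := hK _ a1; have /andP[+ _] := hL _ a1.
rewrite !quant_qerr// !munu.
set u := qerr nu _; set v := qerr nu _.
have u0 : 0 <= u by rewrite /u qerr2_pair powR_ge0.
have v0 : 0 <= v by rewrite /v qerr2_pair powR_ge0.
clearbody u v.
have powC (w : R) : 0 <= w -> w ^+ p + C * w ^+ p.-1 <= (w + C) ^+ p.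
  move=> w0; case: (p) p0 => // k _ /=; rewrite !exprS -mulrDl.
  have wC : 0 <= w + C by rewrite addr_ge0// ltW.
  by rewrite ler_wpM2l// lerXn2r// ?nnegrE// lerDl ltW.
move=> luv huv.
(* If both [u] and [v] were below [a], then $u^p + v^p < 2a^p$, against [luv]; [w] is one of them
   that is at least [a]. *)
have [w w0 [aw hw]] : exists2 w, 0 <= w & a <= w /\ 2 * a ^+ p + C * w ^+ p.-1 <=
     (u + C) ^+ p + (v + C) ^+ p.
  have hu := powC _ u0; have hv := powC _ v0.
  have U0 : 0 <= C * u ^+ p.-1 := mulr_ge0 (ltW C0) (exprn_ge0 _ u0).
  have V0 : 0 <= C * v ^+ p.-1 := mulr_ge0 (ltW C0) (exprn_ge0 _ v0).
  have [au|ua] := leP a u; first by exists u => //; split => //; lra.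
  have [av|va] := leP a v; first by exists v => //; split => //; lra.
  have : u ^+ p < a ^+ p by rewrite ltrXn2r -?lt0n// ltW.
  have : v ^+ p < a ^+ p by rewrite ltrXn2r -?lt0n// ltW.
  lra.
have aw1 : C * a ^+ p.-1 <= C * w ^+ p.-1.
  by rewrite ler_pM2l// lerXn2r// nnegrE ltW.
have : C * a ^+ p.-1 <= K * a ^+ p.-2 by lra.
have -> : p.-1 = p.-2.+1 by case: (p) p2 => [|[]].
rewrite exprS mulrA ler_pM2r ?exprn_gt0//.
rewrite /a mulrDr mulr1 mulrCA divff ?gt_eqF// mulr1.
by have := ler_norm K; lra.
Qed.

(** * Comparison with the Wasserstein distance *)

Lemma Lnorm_exprn d (T : measurableType d) (R : realType)
    (m : {measure set T -> \bar R}) (p : nat) (g : T -> R) :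
  'N[m]_(p%:R%:E) [EFin \o g]%E =
  poweR (\int[m]_x (`|g x| ^+ p)%:E)%E (p%:R^-1).
Proof.
rewrite unlock /Lnorm; congr poweR; apply: eq_integral => x _.
by rewrite /= powR_mulrn.
Qed.

Lemma ge0_integral_fst d1 d2 (T1 : measurableType d1) (T2 : measurableType d2)
    (R : realType) (pi : {measure set (T1 * T2) -> \bar R})
    (mu : {measure set T1 -> \bar R}) (f : T1 -> \bar R) :
  (forall A, measurable A -> pi (A `*` setT) = mu A) ->
  measurable_fun setT f -> (forall x, 0 <= f x)%E ->
  (\int[pi]_z f z.1 = \int[mu]_x f x)%E.
Proof.
move=> pimu mf f0.
rewrite -[LHS](@ge0_integral_pushforward _ _ _ _ _ fst measurable_fst pi setT f)//.
by apply: eq_measure_integral => A mA _; rewrite -pimu// setXT.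
Qed.

Lemma ge0_integral_snd d1 d2 (T1 : measurableType d1) (T2 : measurableType d2)
    (R : realType) (pi : {measure set (T1 * T2) -> \bar R})
    (mu : {measure set T2 -> \bar R}) (f : T2 -> \bar R) :
  (forall A, measurable A -> pi (setT `*` A) = mu A) ->
  measurable_fun setT f -> (forall x, 0 <= f x)%E ->
  (\int[pi]_z f z.2 = \int[mu]_x f x)%E.
Proof.
move=> pimu mf f0.
rewrite -[LHS](@ge0_integral_pushforward _ _ _ _ _ snd measurable_snd pi setT f)//.
by apply: eq_measure_integral => A mA _; rewrite -pimu// setTX.
Qed.

(** The distance to the set $\{a, b\}$ is 1-Lipschitz. *)
Lemma min_dist_lipschitz (R : realDomainType) (a b x y : R) :
  `|Num.min `|x - a| `|x - b| - Num.min `|y - a| `|y - b| | <= `|x - y|.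
Proof.
have ha := ler_distD y x a; have hb := ler_distD y x b.
have ka := ler_distD x y a; have kb := ler_distD x y b.
rewrite (distrC y x) in ka kb.
move: ha hb ka kb.
move: (`|x - a|) (`|x - b|) (`|y - a|) (`|y - b|) (`|x - y|) => A B C D E.
by rewrite ler_norml; have [?|?] := ltP A B; have [?|?] := ltP C D;
  move=> *; apply/andP; split; lra.
Qed.

Lemma min_exprn (R : realDomainType) (p : nat) (x y : R) : 0 <= x -> 0 <= y ->
  Num.min x y ^+ p = Num.min (x ^+ p) (y ^+ p).
Proof.
move=> x0 y0; have [xy|/ltW yx] := leP x y; apply/esym.
  by apply: min_l; rewrite lerXn2r.
by apply: min_r; rewrite lerXn2r.
Qed.

Lemma qerr2_EFin (R : realType) (p : nat) (mu : Pp R p) (x : 'rV[R]_2) :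
  (qerr mu x)%:E =
  poweR (\int[law mu]_xi (Num.min `|(xi : R) - x ord0 ord0|
           `|(xi : R) - x ord0 (lift ord0 ord0)| ^+ p)%:E)%E p%:R^-1.
Proof.
rewrite qerr2E -poweR_EFin /quant /Rintegral fineK.
  by congr poweR; apply: eq_integral => xi _; rewrite min_exprn.
exact: integrable_fin_num (integrable_min _ _ _).
Qed.

(** Under [pi] the two errors are the $L^p$ norms of one 1-Lipschitz function applied to either
    coordinate. The bound is on $p$-th powers because [wasserstein] takes the root after the
    infimum. *)
Lemma qerr2_le_cost (R : realType) (p : nat) (mu nu : Pp R p)
    (pi : probability (measurableTypeR R * measurableTypeR R)%type R)
    (x : 'rV[R]_2) : (0 < p)%N -> coupling mu nu pi ->
  ((`|qerr mu x - qerr nu x| ^+ p)%:E <=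
   \int[pi]_z (`|(z.1 : R) - (z.2 : R)| ^+ p)%:E)%E.
Proof.
move=> p0 [pimu pinu].
set cost := (X in (_ <= X)%E).
have cost0 : (0 <= cost)%E by apply: integral_ge0 => z _; rewrite lee_fin exprn_ge0.
pose f (xi : R) := Num.min `|xi - x ord0 ord0| `|xi - x ord0 (lift ord0 ord0)|.
have f0 xi : 0 <= f xi by rewrite le_min !normr_ge0.
have mf : measurable_fun (setT : set (measurableTypeR R)) (f : measurableTypeR R -> R).
  by apply: measurable_minr; apply: measurableT_comp => //; exact: measurable_funB.
pose f1 (z : measurableTypeR R * measurableTypeR R) : R := f z.1.
pose f2 (z : measurableTypeR R * measurableTypeR R) : R := f z.2.
have mf1 : measurable_fun setT f1.
  by apply: (@measurableT_comp _ _ _ _ _ _ f _ fst).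
have mf2 : measurable_fun setT f2.
  by apply: (@measurableT_comp _ _ _ _ _ _ f _ snd).
have mfp : measurable_fun (setT : set (measurableTypeR R))
    (fun xi : measurableTypeR R => (f xi ^+ p)%:E).
  by apply/measurable_EFinP; exact: measurable_funX.
have N1 : 'N[pi]_(p%:R%:E) [EFin \o f1]%E = (qerr mu x)%:E.
  rewrite Lnorm_exprn qerr2_EFin; congr poweR.
  rewrite -(ge0_integral_fst pimu mfp) => [|xi]; last by rewrite lee_fin exprn_ge0.
  by apply: eq_integral => z _; rewrite ger0_norm// f0.
have N2 : 'N[pi]_(p%:R%:E) [EFin \o f2]%E = (qerr nu x)%:E.
  rewrite Lnorm_exprn qerr2_EFin; congr poweR.
  rewrite -(ge0_integral_snd pinu mfp) => [|xi]; last by rewrite lee_fin exprn_ge0.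
  by apply: eq_integral => z _; rewrite ger0_norm// f0.
have N12 (g1 g2 : measurableTypeR R * measurableTypeR R -> R) :
    measurable_fun setT g1 -> measurable_fun setT g2 ->
    (forall z, `|g1 z - g2 z| <= `|(z.1 : R) - z.2|) ->
    ('N[pi]_(p%:R%:E) [EFin \o g1] <= poweR cost (p%:R^-1)
       + 'N[pi]_(p%:R%:E) [EFin \o g2])%E.
  move=> m1 m2 g12.
  have m12 : measurable_fun setT (g1 \- g2) by exact: measurable_funB.
  have := minkowski_EFin pi m12 m2 (_ : 1 <= p%:R :> R); rewrite ler1n => /(_ p0).
  rewrite (_ : (g1 \- g2) \+ g2 = g1)%R; last by apply/funext => z /=; rewrite subrK.
  move/le_trans; apply; rewrite leeD2r// Lnorm_exprn.
  apply: gt0_ler_poweR; rewrite ?invr_ge0// ?in_itv/= ?leey ?andbT//.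
    by apply: integral_ge0 => z _; rewrite lee_fin exprn_ge0.
  apply: ge0_le_integral => //.
  - apply/measurable_EFinP; apply: measurable_funX; exact: measurableT_comp.
  - apply/measurable_EFinP; apply: measurable_funX; apply: measurableT_comp => //.
    exact: measurable_funB.
  by move=> z _; rewrite lee_fin lerXn2r.
have h1 := N12 _ _ mf1 mf2 (fun z => min_dist_lipschitz _ _ z.1 z.2).
have h2 := N12 _ _ mf2 mf1 (fun z => eq_ind_r (fun r => _ <= r)
  (min_dist_lipschitz _ _ z.2 z.1) (distrC _ _)).
move: h1 h2; rewrite N1 N2; clear N1 N2 N12; clearbody cost.
move: (qerr mu x) (qerr nu x) => u v.
(* An infinite cost makes the bound trivial; otherwise everything is real. *)
case: cost cost0 => [c| |]//; last by move=> *; rewrite leey.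
rewrite lee_fin => c0; rewrite poweR_EFin -!EFinD !lee_fin => h1 h2.
rewrite -[leRHS](powR_invrK p0 c0) lerXn2r// ?nnegrE ?powR_ge0//.
by rewrite ler_norml; apply/andP; split; lra.
Qed.

Lemma wasserstein_ge0 (R : realType) (p : nat) (mu nu : Pp R p) :
  (0 <= wasserstein mu nu)%E.
Proof. exact: poweR_ge0. Qed.

Lemma qerr2_le_wasserstein (R : realType) (p : nat) (mu nu : Pp R p)
    (x : 'rV[R]_2) : (0 < p)%N ->
  ((`|qerr mu x - qerr nu x|)%:E <= wasserstein mu nu)%E.
Proof.
move=> p0; have pn0 : p%:R != 0 :> R by rewrite pnatr_eq0 -lt0n.
rewrite /wasserstein.
have -> : (`|qerr mu x - qerr nu x|)%:E =
    poweR (`|qerr mu x - qerr nu x| ^+ p)%:E p%:R^-1.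
  by rewrite poweR_EFin -powR_mulrn// -powRrM mulfV// powRr1.
have e0 : (0 <= (`|qerr mu x - qerr nu x| ^+ p)%:E)%E by rewrite lee_fin exprn_ge0.
have le : ((`|qerr mu x - qerr nu x| ^+ p)%:E <=
    ereal_inf [set (\int[pi]_z (`|(z.1 : R) - (z.2 : R)| ^+ p)%:E)%E |
                    pi in coupling mu nu])%E.
  by apply: le_ereal_inf_tmp => _ [pi cpi <-]; exact: qerr2_le_cost.
apply: gt0_ler_poweR; rewrite ?invr_ge0 ?in_itv/= ?leey ?andbT//.
exact: le_trans le.
Qed.

Lemma qdist_le_wasserstein (R : realType) (p : nat) (mu nu : Pp R p) :
  (0 < p)%N -> (@qdist R p 2 mu nu <= wasserstein mu nu)%E.
Proof.
by move=> p0; apply: ge_ereal_sup => _ [x _ <-]; exact: qerr2_le_wasserstein.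
Qed.

(** * The quantile coupling *)

Section unit_interval_probability.
Context (R : realType).

Let m01 : measurable (`]0, 1[%classic : set (measurableTypeR R)).
Proof. by []. Qed.

(** The uniform law on []0, 1[], carried by the whole line so that quantile functions are total
    random variables. *)
Definition unit_prob : set (measurableTypeR R) -> \bar R :=
  mrestr (@lebesgue_measure R) m01.

HB.instance Definition _ := Measure.on unit_prob.

Let unit_prob_setT : unit_prob setT = 1%E.
Proof.
rewrite /unit_prob /mrestr setTI; have := @lebesgue_measure_itv R `]0, 1[.
by rewrite /= lte_fin ltr01 => ->; rewrite oppr0 adde0.
Qed.

HB.instance Definition _ :=
  Measure_isProbability.Build _ _ _ unit_prob unit_prob_setT.

End unit_interval_probability.
Arguments unit_prob : clear implicits.

Section quantile.
Context (R : realType).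
Implicit Type mu : probability (measurableTypeR R) R.

(* The value outside [`]0, 1[] is the junk value [0]. *)
Definition quantile mu : measurableTypeR R -> measurableTypeR R :=
  (fun u : R => inf [set x | u <= cdfr mu x]) \_ `]0, 1[%classic.

Lemma quantile_leP mu (u x : R) : 0 < u < 1 -> (quantile mu u <= x) = (u <= cdfr mu x).
Proof.
move=> u01; have /andP[u0 u1] := u01.
rewrite /quantile patchE mem_setE in_itv/= u01.
set E := [set x | u <= cdfr mu x].
have E0 : E !=set0.
  have /(_ _ u u1) := cvgr_gt _ (cvg_cdfry mu).
  move=> [M [_ hM]]; exists (M + 1); apply/ltW/hM; by rewrite ltrDl.
have Elb : has_lbound E.
  have /(_ _ u u0) := cvgr_lt _ (cvg_cdfrNy mu).
  move=> [M [_ hM]]; exists (M - 1) => y Ey; rewrite leNgt; apply/negP => yM.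
  have : cdfr mu y < u by apply: hM; rewrite (lt_trans yM)// gtrBl.
  by rewrite ltNge Ey.
apply/idP/idP => [Ex|ux]; last exact: ge_inf.
apply: cdfr_rlimit => y xy.
have [z Ez zy] := inf_lt E0 (le_lt_trans Ex xy).
exact: le_trans Ez (cdfr_nd _ (ltW zy)).
Qed.

Lemma quantile_out mu (u : R) : ~~ (0 < u < 1) -> quantile mu u = 0.
Proof. by move=> u01; rewrite /quantile patchE mem_setE in_itv/= (negbTE u01). Qed.

Lemma measurable_quantile mu : measurable_fun setT (quantile mu).
Proof.
apply: (iffLR (measurable_restrictT _ _)) => //.
apply: (measurability (@RGenOInfty.G R)) => [|/= _ [_] [x ->] <-].
  exact: RGenOInfty.measurableE.
rewrite (_ : _ `&` _ = `]0, 1[%classic `&` `]cdfr mu x, +oo[%classic).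
  exact: measurableI.
apply/seteqP; split=> u [u01 ux]; split => //; move: ux;
  have := quantile_leP mu x (u01 : 0 < u < 1);
  rewrite /quantile patchE mem_setE in_itv/= (u01 : 0 < u < 1) => h;
  by rewrite /= !in_itv/= !andbT !ltNge h.
Qed.

HB.instance Definition _ mu :=
  isMeasurableFun.Build _ _ _ _ (quantile mu) (measurable_quantile mu).

(** Inverse transform sampling: by [quantile_leP] the preimage of []-oo, x]] in the unit interval
    consists of the $u \le F(x)$, of length $F(x)$. *)
Lemma distribution_quantile mu (A : set (measurableTypeR R)) : measurable A ->
  distribution (unit_prob R) (quantile mu) A = mu A.
Proof.
move: A; apply: eq_cdfr => x; rewrite [LHS]/cdfr.
suff H : distribution (unit_prob R) (quantile mu) `]-oo, x]%classic = (cdfr mu x)%:E.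
  exact: (congr1 fine H).
rewrite /distribution /pushforward /unit_prob /= /mrestr.
have F0 : 0 <= cdfr mu x by rewrite fine_ge0.
have F1 : cdfr mu x <= 1 by rewrite -lee_fin -cdfrE probability_le1.
transitivity (lebesgue_measure (`]0, cdfr mu x]%classic `&` `]0, 1[%classic : set R)).
  congr (lebesgue_measure _); apply/seteqP; split => u [] /= + u01; rewrite !in_itv/= => h; split => //;
    move: h u01; rewrite in_itv/= => h u01; have /andP[u0 u1] := u01;
    move: h; rewrite quantile_leP// u0//.
(* When $F(x) = 1$ the endpoint 1 lies in []0, cdfr mu x]] but not in []0, 1[], so this case is
   separate. *)
move: F1; rewrite le_eqVlt => /predU1P[F1|F1].
  have -> : `]0, cdfr mu x]%classic `&` `]0, 1[%classic = `]0, 1[%classic :> set R.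
    rewrite F1; apply/seteqP; split => u /=; first by case.
    by rewrite !in_itv/= => /andP[-> /[dup] /ltW -> ->].
  have := @lebesgue_measure_itv R `]0, 1[.
  by rewrite /= lte_fin ltr01 => ->; rewrite oppr0 adde0 F1.
have -> : `]0, cdfr mu x]%classic `&` `]0, 1[%classic = `]0, cdfr mu x]%classic :> set R.
  apply/seteqP; split => u /=; first by case.
  by rewrite !in_itv/= => /andP[u0 uF]; rewrite u0 uF (le_lt_trans uF).
have := @lebesgue_measure_itv R `]0, cdfr mu x].
rewrite /= lte_fin => ->; rewrite oppr0 adde0.
case: ifPn => //; rewrite -leNgt => F0'.
by congr EFin; apply/eqP; rewrite eq_le F0 F0'.
Qed.

End quantile.

Lemma ge0_integral_quantile (R : realType) (mu : probability (measurableTypeR R) R)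
    (f : measurableTypeR R -> \bar R) :
  measurable_fun setT f -> (forall x, 0 <= f x)%E ->
  (\int[unit_prob R]_u f (quantile mu u) = \int[mu]_x f x)%E.
Proof.
move=> mf f0.
rewrite -(@ge0_integral_distribution _ _ _ _ _ (unit_prob R) (quantile mu) f)//.
by apply: eq_measure_integral => A mA _; exact: distribution_quantile.
Qed.

(** The comonotone coupling, as a map on the unit interval. *)
Definition quantile_pair (R : realType) (mu nu : probability (measurableTypeR R) R)
  (u : measurableTypeR R) : (measurableTypeR R * measurableTypeR R)%type :=
  (quantile mu u, quantile nu u).

Lemma measurable_quantile_pair (R : realType)
    (mu nu : probability (measurableTypeR R) R) :
  measurable_fun setT (quantile_pair mu nu).
Proof. by apply: measurable_fun_pair; exact: measurable_quantile. Qed.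

HB.instance Definition _ (R : realType)
    (mu nu : probability (measurableTypeR R) R) :=
  isMeasurableFun.Build _ _ _ _ (quantile_pair mu nu)
    (measurable_quantile_pair mu nu).

Lemma coupling_quantile (R : realType) (p : nat) (mu nu : Pp R p) :
  coupling mu nu (distribution (unit_prob R) (quantile_pair (law mu) (law nu))).
Proof.
split=> A mA.
  rewrite -(distribution_quantile (law mu) mA) /distribution /pushforward.
  by congr (unit_prob R _); apply/seteqP; split => u //= -[].
rewrite -(distribution_quantile (law nu) mA) /distribution /pushforward.
by congr (unit_prob R _); apply/seteqP; split => u //= -[].
Qed.

Lemma measurable_quantile_dist (R : realType) (p : nat)
    (mu nu : probability (measurableTypeR R) R) :
  measurable_fun setT (fun u => `|quantile mu u - quantile nu u : R| ^+ p : R).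
Proof.
apply: measurable_funX; apply: measurableT_comp => //.
by apply: measurable_funB; exact: measurable_quantile.
Qed.

Lemma wasserstein_le_quantile (R : realType) (p : nat) (mu nu : Pp R p) :
  (wasserstein mu nu <=
   poweR (\int[unit_prob R]_u
     (`|quantile (law mu) u - quantile (law nu) u : R| ^+ p)%:E) p%:R^-1)%E.
Proof.
apply: gt0_ler_poweR; rewrite ?invr_ge0//.
- rewrite in_itv/= leey andbT; apply: le_ereal_inf_tmp => _ [pi _ <-].
  by apply: integral_ge0 => z _; rewrite lee_fin exprn_ge0.
- rewrite in_itv/= leey andbT.
  by apply: integral_ge0 => z _; rewrite lee_fin exprn_ge0.
apply: ereal_inf_lbound; exists (distribution (unit_prob R) (quantile_pair (law mu) (law nu))).
  exact: coupling_quantile.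
rewrite (@ge0_integral_distribution _ _ _ _ _ (unit_prob R) (quantile_pair (law mu) (law nu)))//.
  apply/measurable_EFinP; apply: measurable_funX; apply: measurableT_comp => //.
  exact: measurable_funB.
Qed.

Lemma integrable_quantile_expr (R : realType) (p : nat) (mu : Pp R p) :
  (unit_prob R).-integrable setT (fun u => (`|quantile (law mu) u : R| ^+ p)%:E).
Proof.
apply/integrableP; split.
  apply/measurable_EFinP; apply: measurable_funX.
  exact: (measurableT_comp (@normr_measurable _ setT) (measurable_quantile (law mu))).
apply: le_lt_trans (finite_moment mu).
rewrite -(@ge0_integral_quantile _ (law mu) (fun x : R => (`|x| ^+ p)%:E)).
- rewrite le_eqVlt; apply/orP; left; apply/eqP; apply: eq_integral => x _.
  by rewrite gee0_abs// lee_fin exprn_ge0.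
- by apply/measurable_EFinP; apply: measurable_funX; exact: normr_measurable.
- by move=> x; rewrite lee_fin exprn_ge0.
Qed.

Lemma dist_exprn_le (R : realDomainType) (p : nat) (x y : R) :
  `|x - y| ^+ p <= 2 ^+ p * (`|x| ^+ p + `|y| ^+ p).
Proof.
apply: le_trans (exprDn_le p (normr_ge0 x) (normr_ge0 y)).
by apply: lerXn2r; rewrite ?nnegrE ?addr_ge0// ler_normB.
Qed.

Lemma integrable_quantile_dist (R : realType) (p : nat) (mu nu : Pp R p) :
  (unit_prob R).-integrable setT
    (fun u => (`|quantile (law mu) u - quantile (law nu) u : R| ^+ p)%:E).
Proof.
have iD := integrableZl measurableT (2 ^+ p)
  (integrableD measurableT (integrable_quantile_expr mu) (integrable_quantile_expr nu)).
apply: le_integrable iD => //.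
  by apply/measurable_EFinP; exact: measurable_quantile_dist.
move=> u _ /=; rewrite lee_fin ger0_norm ?exprn_ge0//.
by apply: le_trans (dist_exprn_le _ _ _) (ler_norm _).
Qed.

Lemma wasserstein_lty (R : realType) (p : nat) (mu nu : Pp R p) :
  (wasserstein mu nu < +oo)%E.
Proof.
apply: le_lt_trans (wasserstein_le_quantile _ _) _; apply: poweR_lty.
by rewrite ltey_eq (integrable_fin_num measurableT (integrable_quantile_dist mu nu)).
Qed.

(** * Convergence of quantile functions, pointwise and in $L^p$ *)

Lemma cvg_quantile (R : realType) (p : nat) (mu_ : nat -> Pp R p.+1)
    (mu : Pp R p.+1) (u : R) :
  (forall m, potential (mu_ n) m @[n --> \oo] --> potential mu m) ->
  (forall q : rat, cdfr (law mu) (ratr q) != u) ->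
  quantile (law (mu_ n)) u @[n --> \oo] --> (quantile (law mu) u : R).
Proof.
move=> potP uq.
have [u01|u01] := boolP (0 < u < 1); last first.
  by rewrite quantile_out//; under eq_fun do rewrite quantile_out//; exact: cvg_cst.
set Q := quantile _ _.
have dpot x y : (potential (mu_ n) x - potential (mu_ n) y) @[n --> \oo] -->
    potential mu x - potential mu y by exact: cvgB.
apply/cvgrPdist_le => e e0.
have Qe : Q < Q + e by rewrite ltrDl.
(* At a rational [q] right of [Q] the connection gives only $u \le F(q)$; the hypothesis on [u]
   makes it strict. The potential increment on $[q, Q+e]$ is then strictly below its threshold,
   which persists for large [n]. *)
have [q /[!in_itv]/= /andP[Qq qe]] := rat_in_itvoo Qe.
have uF : u < cdfr (law mu) (ratr q).
  by rewrite lt_neqAle eq_sym uq/= -quantile_leP// ltW.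
have up : \forall n \near \oo, quantile (law (mu_ n)) u <= Q + e.
  have /andP[_ h] := potential_cdfr mu qe.
  have lt : potential mu (ratr q) - potential mu (Q + e) < (Q + e - ratr q) * (1 - u).
    by rewrite (le_lt_trans h)// ltr_pM2l ?subr_gt0// ltrD2l ltrN2.
  have hup := cvgr_lt _ (dpot (ratr q) (Q + e)) _ lt; near=> n.
  have hn : potential (mu_ n) (ratr q) - potential (mu_ n) (Q + e) <
    (Q + e - ratr q) * (1 - u) by near: n; exact: hup.
  rewrite quantile_leP//.
  have /andP[h' _] := potential_cdfr (mu_ n) qe.
  have := le_lt_trans h' hn; rewrite ltr_pM2l ?subr_gt0// ltrD2l ltrN2.
  exact: ltW.
have lo : \forall n \near \oo, Q - e < quantile (law (mu_ n)) u.
  (* On this side $F(Q - e/2) < u$ is strict directly from the Galois connection; the increment is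
     taken on $[Q-e, Q-e/2]$. *)
  have ee : Q - e < Q - e / 2 by lra.
  have /andP[h _] := potential_cdfr mu ee.
  have Fu : cdfr (law mu) (Q - e / 2) < u.
    by rewrite ltNge -quantile_leP// -ltNge -/Q; lra.
  have lt : (Q - e / 2 - (Q - e)) * (1 - u) < potential mu (Q - e) - potential mu (Q - e / 2).
    by rewrite (lt_le_trans _ h)// ltr_pM2l ?subr_gt0// ltrD2l ltrN2.
  have hlo := cvgr_gt _ (dpot (Q - e) (Q - e / 2)) _ lt; near=> n.
  have hn : (Q - e / 2 - (Q - e)) * (1 - u) <
    potential (mu_ n) (Q - e) - potential (mu_ n) (Q - e / 2) by near: n; exact: hlo.
  have /andP[_ h'] := potential_cdfr (mu_ n) ee.
  have := lt_le_trans hn h'; rewrite ltr_pM2l ?subr_gt0// ltrD2l ltrN2 => Fnu.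
  by rewrite ltNge quantile_leP// -ltNge.
near=> n; rewrite ler_distlC; apply/andP; split; last by near: n.
by apply: ltW; near: n.
Unshelve. all: by end_near. Qed.

Lemma cvg_exprn (R : realType) (p : nat) (f : nat -> R) (l : R) :
  f n @[n --> \oo] --> l -> f n ^+ p @[n --> \oo] --> l ^+ p.
Proof. by move=> fl; exact: (cvg_comp _ _ fl (@exprn_continuous R p l)). Qed.

Lemma cvg_minl (R : realType) (f : nat -> R) (l : R) :
  f n @[n --> \oo] --> l -> Num.min (f n) l @[n --> \oo] --> l.
Proof.
move=> fl; apply/cvgrPdist_le => e e0.
move/cvgrPdist_le: fl => /(_ e e0) fe; near=> n.
apply: (@le_trans _ _ `|l - f n|); last by near: n.
by have [fnl|fnl] := leP (f n) l; rewrite ?subrr ?normr0 ?lexx.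
Unshelve. all: by end_near. Qed.

Lemma unit_prob_countable (R : realType) (A : set (measurableTypeR R)) :
  countable A -> (unit_prob R).-negligible A.
Proof.
move=> cA; exists A; split => //.
- by apply: countable_measurable => // t; exact: measurable_set1.
rewrite /unit_prob/= /mrestr; apply: countable_lebesgue_measure0.
by apply: sub_countable cA; apply: subset_card_le => x [].
Qed.

(** The absolute moment is the error with both centres at 0, so the errors control it. *)
Lemma quant00 (R : realType) (p : nat) (mu : Pp R p) :
  \int[unit_prob R]_u (`|quantile (law mu) u : R| ^+ p) = quant mu 0 0.
Proof.
rewrite /Rintegral /quant /Rintegral; congr fine.
rewrite (@ge0_integral_quantile _ (law mu) (fun x : R => (`|x| ^+ p)%:E)).
- by apply: eq_integral => x _; rewrite minxx subr0.
- by apply/measurable_EFinP; apply: measurable_funX; exact: normr_measurable.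
- by move=> x; rewrite lee_fin exprn_ge0.
Qed.

(** A Scheffé-type argument: almost everywhere convergence together with convergence of the $p$-th
    moments yields $L^p$ convergence. *)
Lemma cvg_quantile_dist (R : realType) (p : nat) (mu_ : nat -> Pp R p.+1)
    (mu : Pp R p.+1) :
  (forall m, potential (mu_ n) m @[n --> \oo] --> potential mu m) ->
  quant (mu_ n) 0 0 @[n --> \oo] --> quant mu 0 0 ->
  \int[unit_prob R]_u (`|quantile (law (mu_ n)) u - quantile (law mu) u : R| ^+ p.+1)
    @[n --> \oo] --> (0 : R).
Proof.
move=> potP momP.
pose Q n u : R := quantile (law (mu_ n)) u.
pose Q0 u : R := quantile (law mu) u.
(* The constant of [dist_exprn_le], which makes [g n] nonnegative; [h] is the almost everywhere
   limit of [g n]. *)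
pose c : R := 2 ^+ p.+1.
pose g n u : R := c * (`|Q n u| ^+ p.+1 + `|Q0 u| ^+ p.+1) - `|Q n u - Q0 u| ^+ p.+1.
pose h u : R := c * (`|Q0 u| ^+ p.+1 + `|Q0 u| ^+ p.+1).
pose k n u : R := Num.min (g n u) (h u).
have iQ n := integrable_quantile_expr (mu_ n).
have iQ0 := integrable_quantile_expr mu.
have id n := integrable_quantile_dist (mu_ n) mu.
have ih : (unit_prob R).-integrable setT (EFin \o h).
  by apply: integrable_EFinZ => //; exact: integrable_EFinD.
have iS n : (unit_prob R).-integrable setT
    (EFin \o (fun u => c * (`|Q n u| ^+ p.+1 + `|Q0 u| ^+ p.+1))).
  by apply: integrable_EFinZ => //; exact: integrable_EFinD (iQ n) iQ0.
have ig n : (unit_prob R).-integrable setT (EFin \o g n).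
  exact: integrable_EFinB (iS n) (id n).
have g0 n u : 0 <= g n u by rewrite subr_ge0; exact: dist_exprn_le.
have h0 u : 0 <= h u by rewrite mulr_ge0 ?exprn_ge0 ?addr_ge0 ?exprn_ge0.
have k0 n u : 0 <= k n u by rewrite le_min g0 h0.
have mk n : measurable_fun setT (k n).
  by apply: measurable_minr; apply/measurable_EFinP; [case/integrableP: (ig n)|case/integrableP: ih].
have kh n u : (`|(k n u)%:E| <= (h u)%:E)%E.
  by rewrite gee0_abs ?lee_fin// ge_min lexx orbT.
have kcvg : {ae unit_prob R, forall u, setT u -> (k n u)%:E @[n --> \oo] --> (h u)%:E}.
  have [N [mN N0 sN]] : (unit_prob R).-negligible
      (range (fun q : rat => cdfr (law mu) (ratr q))).
    by apply: unit_prob_countable; apply: card_le_trans (card_image_le _ _) _; exact: countableP.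
  exists N; split => // u /= nu; apply: sN; apply: contrapT => uq; apply: nu => _.
  have cQ : Q n u @[n --> \oo] --> Q0 u.
    apply: cvg_quantile => // q; apply/eqP => qu; apply: uq; by exists q.
  apply: cvg_EFin; first by near=> n.
  apply: cvg_minl.
  rewrite -[h u]subr0 -[X in _ - X](_ : `|Q0 u - Q0 u| ^+ p.+1 = 0); last first.
    by rewrite subrr normr0 expr0n.
  apply: cvgB; last first.
    by apply: cvg_exprn; apply: cvg_norm; apply: cvgB => //; exact: cvg_cst.
  apply: cvgMl_tmp; apply: cvgD; last exact: cvg_cst.
  by apply: cvg_exprn; apply: cvg_norm.
(* [g n] is not dominated, but its minimum with its limit [h] is, and it bounds
   the cost from above just as well. *)
have [_ _ kint] := dominated_convergence measurableT
  (fun n => (measurable_EFinP _ _).2 (mk n)) (measurable_int _ ih) kcvg ih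
  (aeW _ (fun u n _ => kh n u)).
have Kcvg : \int[unit_prob R]_u k n u @[n --> \oo] --> \int[unit_prob R]_u h u.
  apply: fine_cvg; rewrite fineK//; exact: integrable_fin_num.
have hE : \int[unit_prob R]_u h u = c * (quant mu 0 0 + quant mu 0 0).
  rewrite RintegralZl//.
    by rewrite RintegralD// quant00.
  exact: integrable_EFinD.
have ik n : (unit_prob R).-integrable setT (EFin \o k n).
  apply: le_integrable ih => //; first exact/measurable_EFinP.
  by move=> u _ /=; rewrite lee_fin !ger0_norm// ge_min lexx orbT.
have sE n : \int[unit_prob R]_u (c * (`|Q n u| ^+ p.+1 + `|Q0 u| ^+ p.+1)) =
   c * (quant (mu_ n) 0 0 + quant mu 0 0).
  rewrite RintegralZl//.
    by rewrite RintegralD//; [rewrite -!quant00 | exact: iQ].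
  exact: integrable_EFinD (iQ n) iQ0.
(* The cost is the sum bounding it minus [g n], hence at most that sum minus [k n]; both integrals
   in the upper bound tend to the integral of [h]. *)
apply: (@squeeze_cvgr _ _ _ _ (cst 0)
  (fun n => c * (quant (mu_ n) 0 0 + quant mu 0 0) - \int[unit_prob R]_u k n u)).
- near=> n; apply/andP; split.
    by apply: Rintegral_ge0 => u _; rewrite exprn_ge0.
  rewrite -sE -RintegralB//; apply: le_Rintegral => //.
  + exact: id.
  + exact: integrable_EFinB (iS n) (ik n).
  move=> u _; rewrite lerBrDr addrC -lerBrDr.
  by rewrite ge_min lexx.
- exact: cvg_cst.
- rewrite -[X in _ --> X](subrr (c * (quant mu 0 0 + quant mu 0 0))).
  apply: cvgB; last by rewrite -hE.
  by apply: cvgMl_tmp; apply: cvgD => //; exact: cvg_cst.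
Unshelve. all: by end_near. Qed.

(** * Two laws with the same moments up to order p *)

(* The factor [1 + (-1)^(b + n - k)] is [2] or [0]: the two families are the
   normalized binomial coefficients on either parity class. *)
Definition bin_weight (R : realFieldType) (n : nat) (b : bool) (k : nat) : R :=
  'C(n, k)%:R * (1 + (-1) ^+ b * (-1) ^+ (n - k)) / 2 ^+ n.

Lemma bin_weight_ge0 (R : realFieldType) (n : nat) (b : bool) (k : nat) :
  0 <= bin_weight R n b k.
Proof.
rewrite /bin_weight divr_ge0 ?exprn_ge0// mulr_ge0// -(signr_odd _ (n - k)).
by case: b; case: odd; rewrite /= ?expr0 ?expr1; lra.
Qed.

(** The two families differ only through the sign of a difference of order [n], which annihilates
    polynomials of degree below [n]. *)
Lemma sum_bin_weight (R : realFieldType) (n : nat) (b : bool) (f : nat -> R) :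
  \sum_(k < n.+1) bin_weight R n b k * f k =
  (\sum_(k < n.+1) 'C(n, k)%:R * f k + (-1) ^+ b * fdiff n f) / 2 ^+ n.
Proof.
rewrite /fdiff mulr_sumr -big_split /= mulr_suml; apply: eq_bigr => k _.
rewrite /bin_weight; move: (_ ^-1) ('C(n, k)%:R) (f k) ((-1) ^+ b) ((-1) ^+ (n - k)).
by move=> *; ring.
Qed.

Section bin_prob.
Context (R : realType) (n : nat) (b : bool).

(** The weights have order [n.+1], with atoms at $0, \dots, n+1$, so that the moments up to order
    [n] do not depend on [b]. *)
Definition bin_prob : set (measurableTypeR R) -> \bar R :=
  msum (fun k => mscale (NngNum (bin_weight_ge0 R n.+1 b k))
                   (dirac (k%:R : measurableTypeR R))) n.+2.

HB.instance Definition _ := Measure.on bin_prob.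

Lemma bin_probE (A : set (measurableTypeR R)) :
  bin_prob A = (\sum_(k < n.+2) bin_weight R n.+1 b k * \1_A (k%:R : R))%:E.
Proof.
by rewrite /bin_prob /msum -sumEFin; apply: eq_bigr => k _.
Qed.

Let bin_prob_setT : bin_prob setT = 1%E.
Proof.
rewrite bin_probE; under eq_bigr do rewrite indicT.
rewrite (@sum_bin_weight R n.+1 b (fun=> 1)).
(* The constant 1 is a polynomial of degree 0, so the signed part vanishes and $2^{n+1}$ remains in
   the numerator. *)
rewrite (@eq_fdiff _ _ _ (fun i => (0 + i%:R) ^+ 0))// fdiff_exp// mulr0 addr0.
under eq_bigr do rewrite mulr1.
rewrite -natr_sum -natrX; congr EFin.
suff -> : (\sum_(k < n.+2) 'C(n.+1, k) = 2 ^ n.+1)%N.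
  by rewrite divff// pnatr_eq0 expn_eq0.
rewrite [RHS](Pascal 1 1 n.+1); apply: eq_bigr => k _.
by rewrite !exp1n !muln1.
Qed.

HB.instance Definition _ :=
  Measure_isProbability.Build _ _ _ bin_prob bin_prob_setT.

Lemma integral_bin_prob (f : R -> R) : measurable_fun setT f ->
  (forall x, 0 <= f x) ->
  (\int[bin_prob]_x (f x)%:E =
   (\sum_(k < n.+2) bin_weight R n.+1 b k * f k%:R)%:E)%E.
Proof.
move=> mf f0; have mfE : measurable_fun setT (fun x : measurableTypeR R => (f x)%:E).
  exact/measurable_EFinP.
rewrite ge0_integral_measure_sum//; last by move=> x _; rewrite lee_fin.
rewrite -sumEFin; apply: eq_bigr => k _.
rewrite ge0_integral_mscale//; last by move=> x _; rewrite lee_fin.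
by rewrite integral_dirac//= diracT mul1e.
Qed.

Lemma bin_prob_moment (p : nat) :
  (\int[bin_prob]_xi (`|(xi : R)| ^+ p)%:E < +oo)%E.
Proof.
rewrite (@integral_bin_prob (fun x => `|x| ^+ p)) ?ltry//.
  by apply: measurable_funX; exact: normr_measurable.
Qed.

End bin_prob.
Arguments bin_prob : clear implicits.

Definition bin_law (R : realType) (p : nat) (b : bool) : Pp R p :=
  MkPp (bin_prob_moment R p b p).

(** For even [p] the integrand is a polynomial of degree [p] in the atom, so the difference of order
    $p+1$ vanishes. *)
Lemma qerr1_bin_law (R : realType) (p : nat) (b : bool) (x : 'rV[R]_1) :
  ~~ odd p -> qerr (bin_law R p b) x = qerr (bin_law R p (~~ b)) x.
Proof.
move=> p_even; rewrite !qerr1E; congr (_ `^ _).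
set a := x ord0 ord0; rewrite /quant /Rintegral; congr fine.
have E c : (\int[bin_prob R p c]_xi
      (Num.min (`|(xi : R) - a| ^+ p) (`|(xi : R) - a| ^+ p))%:E =
    ((\sum_(k < p.+2) 'C(p.+1, k)%:R * (- a + k%:R) ^+ p) / 2 ^+ p.+1)%:E)%E.
  rewrite (@integral_bin_prob _ _ _ (fun xi => Num.min (`|xi - a| ^+ p) (`|xi - a| ^+ p))).
  - rewrite (@sum_bin_weight _ _ c
      (fun i => Num.min (`|i%:R - a| ^+ p) (`|i%:R - a| ^+ p))); congr (_%:E); congr (_ / _).
    have D i : Num.min (`|i%:R - a| ^+ p) (`|i%:R - a| ^+ p) = (- a + i%:R) ^+ p.
      by rewrite minxx -normrX ger0_norm ?exprn_even_ge0// addrC.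
    rewrite (eq_fdiff _ D) fdiff_exp// ltn_eqF// mul0n mulr0 addr0.
    by apply: eq_bigr => k _; rewrite D.
  - by apply: measurable_minr; apply: measurable_funX; apply: measurableT_comp => //;
      exact: measurable_funB.
  - by move=> y; rewrite minxx exprn_ge0.
by rewrite [LHS]E [RHS]E.
Qed.

(** The last atom [p.+1] has the positive weight $2/2^{p+1}$ for [false] and weight 0 for [true]. *)
Lemma bin_law_neq (R : realType) (p : nat) :
  ~ eq_law (bin_law R p false) (bin_law R p true).
Proof.
move=> /(_ [set p.+1%:R]) /(_ (measurable_set1 _)).
have E c : bin_prob R p c [set p.+1%:R] = (bin_weight R p.+1 c p.+1)%:E.
  rewrite bin_probE big_ord_recr /= indicE mem_set// mulr1 big1 ?add0r// => k _.
  rewrite indicE memNset ?mulr0//= => /eqP; rewrite eqr_nat ltn_eqF//.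
move=> h; have : (bin_weight R p.+1 false p.+1)%:E = (bin_weight R p.+1 true p.+1)%:E.
  by rewrite -!E.
rewrite /bin_weight binn subnn /= !expr0 expr1 !mulr1 subrr !mul1r mul0r => -[] /eqP.
by rewrite mulf_eq0 invr_eq0 expf_eq0/= -[1 + 1]/(2%:R) !pnatr_eq0.
Qed.

(** * Convergence of the errors *)

Lemma cvg_fdiff (R : realType) (m : nat) (f : nat -> nat -> R) (l : nat -> R) :
  (forall i, f n i @[n --> \oo] --> l i) ->
  fdiff m (f n) @[n --> \oo] --> fdiff m l.
Proof.
move=> fl; apply: cvg_big => [|i _]; first exact: add_continuous.
exact: cvgMl_tmp (fl i).
Qed.

Section qerr2.
Context (R : realType) (k : nat).
(** Here $k = p-1$ is the order of the finite difference that recovers the potential. *)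
Let p := k.+1.
Hypothesis k_odd : odd k.

Let p_even : ~~ odd p. Proof. by rewrite /p /= negbK. Qed.
Let p_ge2 : (2 <= p)%N. Proof. by rewrite /p; case: (k) k_odd. Qed.

Lemma potentialV (mu : Pp R p) (m : R) : potential mu m = ((k.+1)`!.*2%:R)^-1 *
  fdiff k (fun i => quant mu (m - i%:R) (m - i%:R) - quant mu (m - i%:R) (m + i%:R)).
Proof. by rewrite -potentialE// mulKf// pnatr_eq0 -lt0n double_gt0 fact_gt0. Qed.

Lemma separating2 : separating R p 2.
Proof.
move=> mu nu C munu.
have C0 : C = 0 := qerr2_shift_eq0 p_even p_ge2 munu.
have quantE a b : quant mu a b = quant nu a b.
  have q (x : 'rV[R]_2) : qerr mu x = qerr nu x by rewrite munu C0 addr0.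
  by rewrite !(quant_qerr _ _ _ (ltn0Sn k)) q.
split => //; apply: eq_potential => m; rewrite !potentialV.
by congr (_ * _); apply: eq_fdiff => i; rewrite !quantE.
Qed.

Section convergence.
Variables (mu_ : nat -> Pp R p) (mu : Pp R p).
Hypothesis qerrP :
  forall x : 'rV[R]_2, qerr (mu_ n) x @[n --> \oo] --> qerr mu x.

Let quantP a b : quant (mu_ n) a b @[n --> \oo] --> quant mu a b.
Proof.
by rewrite quant_qerr//; under eq_fun do rewrite quant_qerr//; exact: cvg_exprn.
Qed.

Let potentialP m : potential (mu_ n) m @[n --> \oo] --> potential mu m.
Proof.
rewrite potentialV; under eq_fun do rewrite potentialV; apply: cvgMl_tmp.
apply: (@cvg_fdiff _ _ (fun n i => quant (mu_ n) (m - i%:R) (m - i%:R) -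
   quant (mu_ n) (m - i%:R) (m + i%:R))) => i.
by apply: cvgB; exact: quantP.
Qed.

(** The cost of the quantile coupling is symmetric in the laws, hence both orders: convergence has
    the limit as second argument, while [dist_open] has the centre as first. *)
Lemma near_wasserstein (e : R) : 0 < e -> \forall n \near \oo,
  (wasserstein (mu_ n) mu <= e%:E)%E /\ (wasserstein mu (mu_ n) <= e%:E)%E.
Proof.
move=> e0; have ep : 0 < e ^+ p by rewrite exprn_gt0.
have c0 := cvg_quantile_dist potentialP (@quantP 0 0).
have := cvgr_le _ c0 _ ep; set c := Rintegral _ _.
have H n : c (fun u => `|quantile (law (mu_ n)) u - quantile (law mu) u : R| ^+ p)
      <= e ^+ p ->
  (poweR (\int[unit_prob R]_u
     (`|quantile (law (mu_ n)) u - quantile (law mu) u : R| ^+ p)%:E) p%:R^-1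
   <= e%:E)%E.
  rewrite -lee_fin fineK; last exact: integrable_fin_num (integrable_quantile_dist _ _).
  move=> h; have -> : e%:E = poweR (e ^+ p)%:E p%:R^-1.
    by rewrite poweR_EFin -powR_mulrn ?ltW// -powRrM mulfV ?pnatr_eq0// powRr1// ltW.
  apply: gt0_ler_poweR => //.
    rewrite in_itv/= leey andbT.
    by apply: integral_ge0 => z _; rewrite lee_fin exprn_ge0.
  by rewrite in_itv/= leey andbT lee_fin ltW.
move=> near_c; near=> n.
have hn : c (fun u => `|quantile (law (mu_ n)) u - quantile (law mu) u : R| ^+ p)
      <= e ^+ p by near: n; exact: near_c.
split; apply: le_trans (wasserstein_le_quantile _ _) _; first exact: H.
by under eq_integral do rewrite distrC; exact: H.
Unshelve. all: by end_near. Qed.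

Lemma cvg_wasserstein : wasserstein (mu_ n) mu @[n --> \oo] --> 0%E.
Proof.
have fin n : wasserstein (mu_ n) mu \is a fin_num.
  by rewrite ge0_fin_numE ?wasserstein_ge0// wasserstein_lty.
apply/fine_cvgP; split; first exact: nearW.
apply/cvgr0Pnorm_le => e e0; near=> n.
rewrite ger0_norm /= ?fine_ge0 ?wasserstein_ge0// -lee_fin fineK//.
have [] : (wasserstein (mu_ n) mu <= e%:E)%E /\ (wasserstein mu (mu_ n) <= e%:E)%E.
  by near: n; exact: near_wasserstein.
by [].
Unshelve. all: by end_near. Qed.

End convergence.

Lemma wasserstein_uniform (mu_ : nat -> Pp R p) (mu : Pp R p) :
  wasserstein (mu_ n) mu @[n --> \oo] --> 0%E ->
  {uniform, (fun n => (qerr (mu_ n) : 'rV[R]_2 -> R)) @ \oo -->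
                (qerr mu : 'rV[R]_2 -> R)}.
Proof.
move=> W0 P /uniform_nbhs[E [entE EP]].
move: entE; rewrite -entourage_ballE => -[e /= e0 eE].
have /fine_cvgP[Wfin /cvgr0Pnorm_lt/(_ e e0) We] := W0.
near=> n; apply: EP => x _; apply: eE => /=.
rewrite /ball /= distrC -lte_fin.
apply: le_lt_trans (qerr2_le_wasserstein (mu_ n) mu x _) _ => //.
have finn : wasserstein (mu_ n) mu \is a fin_num by near: n.
rewrite -[ltLHS]fineK// lte_fin (le_lt_trans (ler_norm _))//.
by near: n.
Unshelve. all: by end_near. Qed.

Lemma uniform_pointwise (mu_ : nat -> Pp R p) (mu : Pp R p) :
  {uniform, (fun n => (qerr (mu_ n) : 'rV[R]_2 -> R)) @ \oo -->
                (qerr mu : 'rV[R]_2 -> R)} ->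
  forall x : 'rV[R]_2, qerr (mu_ n) x @[n --> \oo] --> qerr mu x.
Proof.
move=> U x.
have := @uniform_subset_cvg _ _ _ _ [set x] _ _ (@subsetT _ _) U.
rewrite uniform_set1 => h; exact: h.
Qed.

(** * The distance $\mathcal{Q}_{2,p}$, its topology, and the minimality of two points *)

Lemma le_qdist (mu nu : Pp R p) (x : 'rV[R]_2) :
  ((`|qerr mu x - qerr nu x|)%:E <= @qdist R p 2 mu nu)%E.
Proof. by apply: ereal_sup_ubound; exists x. Qed.

Lemma qdist_is_distance : is_distance (@qdist R p 2).
Proof.
have Q0 mu nu : (0 <= @qdist R p 2 mu nu)%E.
  by apply: le_trans (le_qdist mu nu 0).
split.
- move=> mu nu; split => //; rewrite ge0_fin_numE//.
  by apply: le_lt_trans (qdist_le_wasserstein _ _ _) (wasserstein_lty _ _).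
- move=> mu nu; split=> [Q|munu].
    (* Zero distance makes all errors equal, which is the case $C = 0$ of separation. *)
    apply: (@separating2 _ _ 0 _).1 => x; rewrite addr0; apply/eqP.
    by have := le_qdist mu nu x; rewrite Q lee_fin normr_le0 subr_eq0.
  apply/eqP; rewrite eq_le Q0 andbT; apply: ge_ereal_sup => _ [x _ <-].
  have qE a b : quant mu a b = quant nu a b.
    rewrite /quant /Rintegral; congr fine.
    by apply: eq_measure_integral => A mA _; exact: (munu A mA).
  by rewrite !qerr2E qE subrr normr0.
- move=> mu nu; rewrite /qdist; congr (ereal_sup _); apply: eq_imagel => x _.
  by congr EFin; exact: distrC.
- move=> mu nu rho; apply: ge_ereal_sup => _ [x _ <-].
  apply: le_trans (leeD (le_qdist mu nu x) (le_qdist nu rho x)).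
  by rewrite -EFinD lee_fin ler_distD.
Qed.

Lemma qdist_wasserstein_topologically_equivalent :
  topologically_equivalent (@qdist R p 2) (@wasserstein R p).
Proof.
move=> U; split=> oU mu Umu.
  have [e e0 he] := oU _ Umu; exists e => // nu W; apply: he.
  exact: le_lt_trans (qdist_le_wasserstein _ _ _) W.
have [e e0 he] := oU _ Umu; apply: contrapT => nQ.
(* Half the radius, since [near_wasserstein] gives a large inequality and a ball needs a strict
   one. *)
have e2 : 0 < e / 2 by rewrite divr_gt0.
(* If no $\mathcal{Q}$-ball around [mu] lies in [U], choose points outside [U] at
   $\mathcal{Q}$-distance below $1/(n+1)$. Their errors converge pointwise, so they enter the
   $\mathcal{W}_p$-ball contained in [U]. *)
have /choice[nu_ hnu] : forall n : nat, exists nu,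
    (@qdist R p 2 mu nu < (n.+1%:R^-1 : R)%:E)%E /\ ~ U nu.
  move=> n; apply: contrapT => hn; apply: nQ; exists n.+1%:R^-1 => // nu Q.
  by apply: contrapT => nU; apply: hn; exists nu.
have nuP (x : 'rV[R]_2) : qerr (nu_ n) x @[n --> \oo] --> qerr mu x.
  apply/cvgrPdist_le => d d0; near=> n.
  have [Qn _] := hnu n; rewrite -lee_fin (le_trans (le_qdist _ _ _))//.
  rewrite (le_trans (ltW Qn))// lee_fin ltW//; near: n.
  exact: (near_infty_natSinv_lt (PosNum d0)).
have [n _ /(_ n (leqnn _))[_ Wn]] := near_wasserstein nuP e2.
have [_] := hnu n; apply; apply: he; apply: le_lt_trans Wn _.
by rewrite lte_fin; lra.
Unshelve. all: by end_near. Qed.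

Lemma is_N1_2 : is_N1 R p 2.
Proof.
split.
  split => //; first exact: separating2.
  by move=> mu_ mu; exact: cvg_wasserstein.
(* Only one point has to be excluded; there the two binomial laws have equal errors but differ. *)
move=> [|[|M]] [//= _ sep _].
have [] := sep (bin_law R p false) (bin_law R p true) 0.
  by move=> x; rewrite addr0 qerr1_bin_law.
by move/bin_law_neq.
Qed.

End qerr2.

Theorem proposition4p2 (R : realType) (p : nat)
    (p_ge2 : (2 <= p)%N) (p_even : ~~ odd p) :
  (* (a) *)
  (forall (mu nu : Pp R p) (C : R),
     (forall x : 'rV[R]_2, qerr mu x = qerr nu x + C) -> eq_law mu nu) /\
  (* (b) *)
  (forall (mu_ : nat -> Pp R p) (mu : Pp R p),
     (wasserstein (mu_ n) mu @[n --> \oo] --> 0%E <->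
      {uniform, (fun n => (qerr (mu_ n) : 'rV[R]_2 -> R)) @ \oo -->
                (qerr mu : 'rV[R]_2 -> R)}) /\
     ({uniform, (fun n => (qerr (mu_ n) : 'rV[R]_2 -> R)) @ \oo -->
                (qerr mu : 'rV[R]_2 -> R)} <->
      forall x : 'rV[R]_2, qerr (mu_ n) x @[n --> \oo] --> qerr mu x)) /\
  (* (c) *)
  (is_distance (@qdist R p 2) /\
   topologically_equivalent (@qdist R p 2) (@wasserstein R p) /\
   is_N1 R p 2).
Proof.
case: p p_ge2 p_even => [|k _ /negPn k_odd]; first by [].
split; first by move=> mu nu C /(separating2 k_odd)[].
split; last first.
  split; first exact: qdist_is_distance.
  by split; [exact: qdist_wasserstein_topologically_equivalent|exact: is_N1_2].
move=> mu_ mu; split; split.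
- exact: wasserstein_uniform.
- by move=> U; apply: cvg_wasserstein => //; exact: uniform_pointwise.
- exact: uniform_pointwise.
- by move=> P; apply: wasserstein_uniform; exact: cvg_wasserstein.
Qed.
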